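(* For every $\epsilon>0$ there is a constant $C_\epsilon>0$, depending only on $\epsilon$, such that the following holds. Let $N$ be a (large) positive integer, let $\{a_n\}_{n=1}^N$ be a complex sequence, and consider $$f(x,t)=\sum_{n=1}^N a_n e(nx+n^2t)$$ on the torus $\mathbb T^2$. For each integer $j\in[1,N]$ let $$S_j=[0,1]\times\Big[\frac{j-1}{N},\frac{j}{N}\Big]\subset[0,1]^2,$$ let $B_j\subset S_j$ be an arbitrarily chosen $\frac1N\times\frac1{N^2}$ box, and let $E=\bigcup_{j=1}^N B_j$. Then $$\Big\|\sum_{n=1}^N a_n e(nx+n^2t)\Big\|_{L^4(E)}\ \le\ C_\epsilon N^{\epsilon}\,N^{-1/4}\,\|a_n\|_{l^2}.$$
   Context: Notation: $e(z)=e^{2\pi i z}$ for $z\in\mathbb R$; $\mathbb T^2=\mathbb R^2/\mathbb Z^2$ is identified with $[0,1]^2$. A $\frac1N\times\frac1{N^2}$ box is an axis-parallel rectangle of side length $\frac1N$ in the $x$-direction and $\frac1{N^2}$ in the $t$-direction. $\|a_n\|_{l^2}=(\sum_{n=1}^N|a_n|^2)^{1/2}$. *)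

(* Defs.v *)
From mathcomp Require Import all_boot all_order all_algebra.
From mathcomp Require Import complex.
From mathcomp Require Import all_classical all_reals all_analysis.

Set Implicit Arguments.
Unset Strict Implicit.
Unset Printing Implicit Defensive.

Import Order.TTheory GRing.Theory Num.Theory.
Import numFieldNormedType.Exports.

Local Open Scope classical_set_scope.
Local Open Scope ring_scope.
Local Open Scope complex_scope.

(* e(z) = exp(2 pi i z) for real z, written out by Euler's formula. *)
Definition expe (R : realType) (z : R) : R[i] :=
  cos (2 * pi * z) +i* sin (2 * pi * z).

(* Only the coefficients a 1, ..., a N are used. *)
Definition expsum (R : realType) (N : nat) (a : nat -> R[i]) (z : R * R)
    : R[i] :=
  \sum_(1 <= n < N.+1) a n * expe (n%:R * z.1 + n%:R ^+ 2 * z.2).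

Definition l2norm (R : realType) (N : nat) (a : nat -> R[i]) : R :=
  Num.sqrt (\sum_(1 <= n < N.+1) (Normc.normc (a n)) ^+ 2).

Definition strip (R : realType) (N j : nat) : set (R * R) :=
  `[0, 1] `*` `[(j%:R - 1) / N%:R, j%:R / N%:R].

Definition is_box (R : realType) (w h : R) (B : set (R * R)) : Prop :=
  exists x0 t0 : R, B = `[x0, x0 + w] `*` `[t0, t0 + h].

(* The L^p(E) norm of a complex-valued function: `|f| \_ E` is |f| on E and 0
   elsewhere, and for 0 < p < +oo the library's Lnorm is
   (\int |f|^p)^(1/p). *)
Definition LnormE (R : realType) (p : R) (E : set (R * R)) (f : R * R -> R[i])
    : \bar R :=
  Lnorm (@lebesgue_measure R \x @lebesgue_measure R)%E p%:E
    ((fun z => (Normc.normc (f z))%:E) \_ E).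

(* Main.v *)
Require Import Defs.
From mathcomp Require Import all_boot all_order all_algebra.
From mathcomp Require Import complex.
From mathcomp Require Import all_classical all_reals all_analysis.
From mathcomp Require Import measurable_realfun.
From mathcomp Require Import ring lra zify.

Import Order.TTheory GRing.Theory Num.Theory.
Import numFieldNormedType.Exports.

Local Open Scope ring_scope.

(** Only one point per box matters: if [z_j] almost maximises [|f|] on [B_j],
the integral over [E] is at most [2 N^-3] times the sum of the [|f(z_j)|^4], so
the claim reduces to
  [\sum_j |f(x_j,t_j)|^4 <= C N^(2+eps) (\sum_n |a_n|^2)^2]
for points whose heights [t_j] lie one in each interval of length [1/N].

Write [F_j = f(x_j,t_j)], [S = \sum_j |F_j|^4] and let [K_jk] be the exponential
sum with all coefficients equal to 1 at the difference of the points [j] and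
[k]. Duality (the TT* method) bounds [S^2] by [\sum |a_n|^2] times
[\sum_jk |F_j|^3 |F_k|^3 |K_jk|], and Cauchy-Schwarz, splitting the cubes as
[|F_j|^2 |F_j|], bounds the latter by [S V^(1/2)], where
  [V = \sum_jk b_j b_k |K_jk|^2] and [b_j = |F_j|^2].
As [\sum_j b_j^2 = S], it suffices to prove [V <= C N^(2+eps) \sum_j b_j^2]
([kernel_second_moment_le]); then [discrete_l4] follows by cancelling [S^3].

To bound [V], expand [|K_jk|^2] over pairs [n, n'] and put [h = n - n'],
[s = n + n']. Then [V] is a sum over [h] and [s] of squares
[|\sum_j b_j e(h x_j) e(h s t_j)|^2]. For fixed [h], the arbitrary phases
[e(h x_j)] can be dropped at the cost of a constant: a sum of squares over an
interval of [s] is dominated by a quadratic form with a nonnegative (Fejer type)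
kernel, for which only the moduli of the coefficients count
([phase_removal]). What remains depends on the product [l = h s] alone, every
[l > 0] arises at most [d(l) = O(l^eps)] times ([divisor_bound]), and
[\sum_(l < 4 N^2) |\sum_j b_j e(l t_j)|^2] is [O(N^2 \sum_j b_j^2)] by the large
sieve, because the [t_j] are essentially [1/N]-separated modulo 1
([large_sieve]). The terms [h = 0] and [s = 0] contribute
[O(N (\sum_j b_j)^2)], which is [O(N^2 \sum_j b_j^2)] as there are [N] points.
*)

(** * Finite sums and the Cauchy-Schwarz inequality *)

Lemma eq_ler {R : numDomainType} (x y : R) : x = y -> x <= y.
Proof. by move=> ->. Qed.

Lemma sum_ge0_prefix {R : numDomainType} (g : nat -> R) (m n : nat) :
  (forall i, 0 <= g i) -> (m <= n)%N ->
  \sum_(0 <= i < m) g i <= \sum_(0 <= i < n) g i.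
Proof.
move=> g0 mn; rewrite (@big_cat_nat _ _ _ m 0 n) //=.
by rewrite lerDl sumr_ge0.
Qed.

Lemma cauchy_schwarz {C : numClosedFieldType} {J : finType} (x y : J -> C) :
  `|\sum_j x j * y j| ^+ 2 <= (\sum_j `|x j| ^+ 2) * (\sum_j `|y j| ^+ 2).
Proof.
set X := \sum_j `|x j| ^+ 2; set Y := \sum_j `|y j| ^+ 2.
set Z := \sum_j x j * y j.
(* Lagrange's identity. *)
have lagrange : \sum_j \sum_k `|x j * (y k)^* - x k * (y j)^*| ^+ 2
    = (X * Y - `|Z| ^+ 2) *+ 2.
  have -> : (X * Y - `|Z| ^+ 2) *+ 2 = X * Y + Y * X - (Z * Z^* + Z^* * Z).
    by rewrite normCK; ring.
  rewrite /X /Y /Z rmorph_sum /= !big_distrlr /= -!big_split /= -sumrB.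
  apply: eq_bigr => j _; rewrite -!big_split /= -sumrB.
  by apply: eq_bigr => k _; rewrite !normCK !rmorphB !rmorphM /= !conjCK; ring.
have : 0 <= (X * Y - `|Z| ^+ 2) *+ 2.
  rewrite -lagrange; apply: sumr_ge0 => j _; apply: sumr_ge0 => k _.
  by rewrite exprn_ge0.
by rewrite pmulrn_lge0 // subr_ge0.
Qed.

(** * Squares of exponential sums as positive kernels *)

(** Here [z j] stands for [e(theta_j)], so that the powers of [z j] are the
characters [e(s theta_j)]. *)
Section DirichletKernel.
Context {C : numClosedFieldType} {J : finType}.

Definition dirichlet (M : nat) (w : C) : C := \sum_(0 <= m < M) w ^+ m.

Definition trigsum (c z : J -> C) (s : nat) : C := \sum_j c j * z j ^+ s.

Lemma sum_sqr_correlation (c : J -> C) (p : nat -> J -> C) (M : nat) :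
  \sum_(0 <= m < M) \sum_(0 <= m' < M)
     `|\sum_j c j * (p m j * (p m' j)^*)| ^+ 2
  = \sum_j \sum_k c j * (c k)^* *
      `|\sum_(0 <= m < M) p m j * (p m k)^*| ^+ 2.
Proof.
under eq_bigr => m _.
  under eq_bigr => m' _ do rewrite normCK rmorph_sum big_distrlr /=.
  rewrite exchange_big /=.
  under eq_bigr => j _ do rewrite exchange_big /=.
  over.
rewrite exchange_big /=; apply: eq_bigr => j _.
rewrite exchange_big /=; apply: eq_bigr => k _.
rewrite normCK rmorph_sum big_distrlr /= mulr_sumr.
apply: eq_bigr => m _; rewrite mulr_sumr.
by apply: eq_bigr => m' _; rewrite !(rmorphM, conjCK) /=; ring.
Qed.

Lemma sum_sqr_trigsum (c z : J -> C) (M : nat) :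
  \sum_(0 <= m < M) \sum_(0 <= m' < M)
     `|\sum_j c j * (z j ^+ m * (z j ^+ m')^*)| ^+ 2
  = \sum_j \sum_k c j * (c k)^* * `|dirichlet M (z j * (z k)^*)| ^+ 2.
Proof.
rewrite (sum_sqr_correlation c (fun m j => z j ^+ m)).
apply: eq_bigr => j _; apply: eq_bigr => k _; congr (_ * `|_| ^+ 2).
by apply: eq_bigr => m _; rewrite exprMn rmorphXn.
Qed.

Lemma expr_conj_shift (z : C) (s m : nat) : `|z| = 1 ->
  z ^+ (m + s) * (z ^+ m)^* = z ^+ s.
Proof. by move=> z1; rewrite exprD mulrAC -normCK normrX z1 !expr1n mul1r. Qed.

Lemma trigsum_shift (c z : J -> C) (s m : nat) : (forall j, `|z j| = 1) ->
  \sum_j c j * (z j ^+ (m + s) * (z j ^+ m)^*) = trigsum c z s.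
Proof. by move=> z1; apply: eq_bigr => j _; rewrite expr_conj_shift. Qed.

(** Averaging over translates: each frequency [s < S] is a difference [m - m']
with [m, m' < 2S] in at least [S] ways, and the sum over all pairs [m, m'] is the
quadratic form of the nonnegative kernel [|D|^2], in which the arguments of the
[c j] can only produce cancellation. *)
Lemma trigsum_le_dirichlet (c z : J -> C) (S : nat) : (forall j, `|z j| = 1) ->
  S%:R * \sum_(0 <= s < S) `|trigsum c z s| ^+ 2
  <= \sum_j \sum_k `|c j| * `|c k| *
       `|dirichlet (S + S) (z j * (z k)^*)| ^+ 2.
Proof.
move=> z1.
pose T m m' := `|\sum_j c j * (z j ^+ m * (z j ^+ m')^*)| ^+ 2.
have T0 m m' : 0 <= T m m' by rewrite exprn_ge0.
apply: (@le_trans _ _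
  (\sum_(0 <= m < S + S) \sum_(0 <= m' < S + S) T m m')).
  rewrite exchange_big /=.
  apply: le_trans (sum_ge0_prefix _ _ _ _ (leq_addr S S)); last first.
    by move=> m'; apply: sumr_ge0.
  rewrite mulr_natl -[X in _ *+ X](subn0 S) -sumr_const_nat.
  apply: ler_sum_nat => m' /= lt_m'S.
  rewrite (@big_cat_nat _ _ _ m' 0 (S + S)) //=; last by lia.
  rewrite (@big_cat_nat _ _ _ (S + m') m' (S + S)) //=; try lia.
  rewrite -[m' in X in _ + (X + _)]add0n big_addn addnK.
  under [X in _ + (X + _)]eq_bigr => s _ do
    rewrite /T addnC trigsum_shift //.
  rewrite [leRHS]addrCA lerDl addr_ge0 // sumr_ge0 //.
rewrite sum_sqr_trigsum.
set V := (X in X <= _).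
have V0 : 0 <= V.
  rewrite /V -sum_sqr_trigsum.
  by apply: sumr_ge0 => m _; apply: sumr_ge0 => m' _; apply: T0.
rewrite -(ger0_norm V0); apply: le_trans (ler_norm_sum _ _ _) _.
apply: ler_sum => j _; apply: le_trans (ler_norm_sum _ _ _) _.
apply: ler_sum => k _.
by rewrite 2!normrM norm_conjC [X in _ * X]ger0_norm ?exprn_ge0.
Qed.

(** The converse bound, for nonnegative coefficients: every difference of two
integers below [M] has modulus below [M], and each modulus occurs at most [2M]
times. Conjugation identifies a frequency with its opposite because the [b j]
are real. *)
Lemma dirichlet_le_trigsum (b z : J -> C) (M : nat) :
  (forall j, `|z j| = 1) -> (forall j, 0 <= b j) ->
  \sum_j \sum_k b j * b k * `|dirichlet M (z j * (z k)^*)| ^+ 2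
  <= 2 * M%:R * \sum_(0 <= s < M) `|trigsum b z s| ^+ 2.
Proof.
move=> z1 b0.
have bR j : (b j)^* = b j by rewrite conj_Creal // ger0_real.
under eq_bigr do under eq_bigr => k _ do rewrite -{1}[b k]bR.
rewrite -sum_sqr_trigsum exchange_big /=.
rewrite mulrC mulrA mulr_natr -[X in _ *+ X](subn0 M) -sumr_const_nat.
apply: ler_sum_nat => m /= lt_mM.
rewrite mulr_natr mulr2n [leLHS](@big_cat_nat _ _ _ m 0 M) //=; last exact: ltnW.
apply: lerD.
  apply: le_trans (sum_ge0_prefix _ _ _ _ lt_mM); last first.
    by move=> s; rewrite exprn_ge0.
  rewrite [leRHS]big_nat_recl // ler_wpDl ?exprn_ge0 // big_nat_rev /= add0n.
  apply: ler_sum_nat => s /= lt_sm.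
  rewrite -(norm_conjC (trigsum b z s.+1)) -(trigsum_shift _ _ _ (m - s.+1)) //.
  rewrite subnK // rmorph_sum /=.
  by under [in leRHS]eq_bigr do
    rewrite !rmorphM /= conjCK bR [X in _ * X]mulrC.
rewrite -{1}[m]add0n big_addn.
under eq_bigr => s _ do rewrite addnC trigsum_shift //.
apply: (sum_ge0_prefix (fun s => `|trigsum b z s| ^+ 2)); last exact: leq_subr.
by move=> s; rewrite exprn_ge0.
Qed.
End DirichletKernel.

(** * Phase removal and the large sieve *)

Section LargeSieve.
Context {C : numClosedFieldType} {J : finType}.

(** The unimodular factors of the coefficients cost only a constant and a
doubling of the range: both sides compare with the same nonnegative kernel. *)
Lemma phase_removal (c z : J -> C) (S : nat) : (forall j, `|z j| = 1) ->
  \sum_(0 <= s < S) `|trigsum c z s| ^+ 2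
  <= 4 * \sum_(0 <= s < S + S) `|trigsum (fun j => `|c j|) z s| ^+ 2.
Proof.
move=> z1; case: S => [|S].
  by rewrite !big_geq // mulr0.
rewrite -(ler_pM2l (_ : 0 < S.+1%:R)) ?ltr0n //.
apply: le_trans (trigsum_le_dirichlet c z S.+1 z1) _.
apply: le_trans (dirichlet_le_trigsum (fun j => `|c j|) z _ z1 _) _ => //.
by rewrite natrD; apply: eq_ler; ring.
Qed.

Lemma dirichlet_le (M : nat) (w : C) : `|w| = 1 -> `|dirichlet M w| <= M%:R.
Proof.
move=> w1; apply: le_trans (ler_norm_sum _ _ _) _.
under eq_bigr do rewrite normrX w1 expr1n.
by rewrite sumr_const_nat subn0.
Qed.

(** The geometric sum; the product form avoids dividing by [w - 1]. *)
Lemma dirichlet_far (M : nat) (w : C) : `|w| = 1 ->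
  `|dirichlet M w| * `|w - 1| <= 2.
Proof.
move=> w1; rewrite -normrM mulrC /dirichlet big_mkord -subrX1.
by apply: le_trans (ler_normB _ _) _; rewrite normrX w1 expr1n normr1.
Qed.

(** Schur's test in the symmetric case, from [2 b_j b_k <= b_j^2 + b_k^2]. *)
Lemma schur_symmetric (b : J -> C) (m : J -> J -> C) (A : C) :
  (forall j, 0 <= b j) -> (forall j k, 0 <= m j k) ->
  (forall j k, m j k = m k j) -> (forall j, \sum_k m j k <= A) ->
  \sum_j \sum_k b j * b k * m j k <= A * \sum_j b j ^+ 2.
Proof.
move=> b0 m0 mC mA; rewrite -(ler_pM2l (_ : 0 < 2)) ?ltr0n //.
apply: (@le_trans _ _ (\sum_j \sum_k (b j ^+ 2 * m j k + b k ^+ 2 * m k j))).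
  rewrite mulr_sumr; apply: ler_sum => j _; rewrite mulr_sumr.
  apply: ler_sum => k _; rewrite -(mC j k) -mulrDl mulrA ler_wpM2r //.
  rewrite -subr_ge0.
  have -> : b j ^+ 2 + b k ^+ 2 - 2 * (b j * b k) = (b j - b k) ^+ 2 by ring.
  by rewrite real_exprn_even_ge0 // realB // ger0_real.
under eq_bigr do rewrite big_split /=.
rewrite big_split /= [X in _ + X]exchange_big /= -mulr2n -[leLHS]mulr_natl.
rewrite ler_wpM2l ?ler0n // mulr_sumr; apply: ler_sum => j _.
by rewrite -mulr_sumr [leRHS]mulrC ler_wpM2l // exprn_ge0.
Qed.

(** A crude large sieve. Since [N^2 <= L], the trivial bound [N] for the
Dirichlet kernel at [far] pairs is enough: there are at most [N] of them in each
row, contributing [N^3 <= L^2] together, while each of the [K] [near] pairs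
contributes at most [4 L^2]. *)
Lemma large_sieve (b z : J -> C) (near : J -> pred J) (K N L : nat) :
  (forall j, `|z j| = 1) -> (forall j, 0 <= b j) ->
  (#|J| <= N)%N -> (N ^ 2 <= L)%N -> (forall j, #|near j| <= K)%N ->
  (forall j k, ~~ near j k -> 2 <= N%:R * `|z j - z k|) ->
  \sum_(0 <= l < L) `|trigsum b z l| ^+ 2
  <= 4 * K.+1%:R * L%:R * \sum_j b j ^+ 2.
Proof.
move=> z1 b0 cardJ NL cardnear far; case: (posnP L) => [->|L0].
  by rewrite big_geq // mulr0 mul0r.
have w1 j k : `|z j * (z k)^*| = 1 by rewrite normrM norm_conjC !z1 mulr1.
rewrite -(ler_pM2l (_ : 0 < L%:R)) ?ltr0n //.
apply: le_trans (trigsum_le_dirichlet b z L z1) _.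
under eq_bigr => j _ do under eq_bigr => k _ do
  rewrite (ger0_norm (b0 j)) (ger0_norm (b0 k)).
rewrite mulrA; apply: schur_symmetric => //.
  move=> j k; congr (_ ^+ 2); rewrite -norm_conjC /dirichlet rmorph_sum.
  by congr `|_|; apply: eq_bigr => m _; rewrite rmorphXn rmorphM /= conjCK mulrC.
move=> j.
have term k : `|dirichlet (L + L) (z j * (z k)^*)| ^+ 2
    <= (near j k)%:R * (2 * L%:R) ^+ 2 + N%:R ^+ 2.
  have [nearjk|/far farjk] := boolP (near j k).
    rewrite mul1r ler_wpDr ?exprn_ge0 ?ler0n //.
    rewrite lerXn2r ?nnegrE ?mulr_ge0 ?ler0n //.
    by apply: le_trans (dirichlet_le _ _ (w1 j k)) _; rewrite natrD mulr_natl.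
  rewrite mul0r add0r lerXn2r ?nnegrE ?ler0n //.
  rewrite -(ler_pM2r (_ : 0 < 2)) ?ltr0n //.
  apply: le_trans (ler_wpM2l _ farjk) _ => //.
  rewrite mulrCA ler_wpM2l ?ler0n //.
  have -> : `|z j - z k| = `|z j * (z k)^* - 1|.
    rewrite -[LHS]mulr1 -(z1 k) -[X in _ * X]norm_conjC -normrM mulrBl.
    by rewrite -normCK z1 expr1n.
  exact: dirichlet_far.
apply: le_trans (ler_sum _ (fun k _ => term k)) _.
rewrite big_split /= sumr_const -mulr_suml -natr_sum.
rewrite -[_ *+ #|_|]mulr_natr -!natrM -!natrX -!natrM -natrD ler_nat.
have -> : (\sum_k near j k = #|near j|)%N by rewrite -sum1_card [RHS]big_mkcond.
apply: (@leq_trans (K * (2 * L) ^ 2 + L * L)%N).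
  apply: leq_add; first by rewrite leq_mul2r cardnear orbT.
  rewrite mulnC; apply: (@leq_trans (N * N ^ 2)%N).
    by rewrite leq_mul2r cardJ orbT.
  apply: leq_mul => //; apply: leq_trans NL; case: (N) => // n; rewrite -mulnn.
  by rewrite leq_pmulr.
rewrite -mulnn; nia.
Qed.
End LargeSieve.

(** * Counting by differences, sums and products *)

Lemma sum_inj_le {R : numDomainType} {I J : finType} (P : pred I) (Q : pred J)
    (phi : I -> J) (F : J -> R) :
  {in P &, injective phi} -> (forall i, P i -> Q (phi i)) ->
  (forall j, 0 <= F j) ->
  \sum_(i | P i) F (phi i) <= \sum_(j | Q j) F j.
Proof.
move=> inj PQ F0.
rewrite -(big_imset (h := phi) F (A := P)) //=.
rewrite [leRHS](bigID (mem (phi @: P))) /=.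
rewrite (eq_bigl (fun j => Q j && (j \in phi @: P))); last first.
  move=> j; apply/idP/andP => [jP|[]//]; split=> //.
  by case/imsetP: jP => i Pi ->; apply: PQ.
by rewrite lerDl sumr_ge0.
Qed.

(** Grouping the pairs [h, s] by their product [l]; the factor [h] determines
[s], so [l] occurs at most once for each of its divisors. *)
Lemma sum_divisors_le {R : numDomainType} (g : nat -> R) (H S D : nat) :
  (forall l, 0 <= g l) ->
  (forall l, (0 < l < H * S)%N -> (size (divisors l) <= D)%N) ->
  \sum_(1 <= h < H) \sum_(1 <= s < S) g (h * s)%N
  <= D%:R * \sum_(0 <= l < H * S) g l.
Proof.
move=> g0 hD.
pose mult l := (\sum_(1 <= h < H) \sum_(1 <= s < S) (l == h * s))%N.
have -> : \sum_(1 <= h < H) \sum_(1 <= s < S) g (h * s)%N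
    = \sum_(0 <= l < H * S) (mult l)%:R * g l.
  under [RHS]eq_bigr do rewrite natr_sum mulr_suml.
  rewrite [RHS]exchange_big /=; apply: eq_big_nat => h /andP[h1 hH].
  under [RHS]eq_bigr do rewrite natr_sum mulr_suml.
  rewrite [RHS]exchange_big /=; apply: eq_big_nat => s /andP[s1 sS].
  rewrite (bigD1_seq (h * s)%N) ?iota_uniq //=; last first.
    by rewrite mem_index_iota /= ltn_mul.
  rewrite eqxx mul1r big1 ?addr0 // => l /negPf lhs.
  by rewrite lhs mul0r.
rewrite mulr_sumr; apply: ler_sum_nat => l /= lHS.
apply: ler_wpM2r => //; rewrite ler_nat.
case: (posnP l) => [->|l0].
  rewrite /mult big_nat big1 // => h /andP[h1 _].
  by rewrite big_nat big1 // => s /andP[s1 _]; case: h s h1 s1 => [|h] [|s].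
apply: leq_trans (hD l _); last by rewrite l0.
apply: (@leq_trans (\sum_(1 <= h < H) (h %| l))%N).
  rewrite /mult big_nat [leqRHS]big_nat; apply: leq_sum => h /andP[h1 _].
  case: (boolP (h %| l)%N) => [/dvdnP[q lq]|ndvd]; last first.
    rewrite big1 // => s _; case: eqP => // lhs.
    by rewrite lhs dvdn_mulr in ndvd.
  apply: (@leq_trans (\sum_(1 <= s < S) (s == q))%N).
    apply: leq_sum => s _; rewrite lq mulnC eqn_pmul2l //.
    by rewrite eq_sym.
  rewrite -big_mkcond sum1_count.
  by rewrite count_uniq_mem ?iota_uniq ?leq_b1.
rewrite -big_mkcond sum1_count -size_filter.
apply: uniq_leq_size; first by rewrite filter_uniq ?iota_uniq.
by move=> h; rewrite mem_filter => /andP[hl _]; rewrite -dvdn_divisors.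
Qed.

Lemma sum_symmetric_triangle {R : comNzRingType} (T : nat -> nat -> R) (N : nat) :
  (forall i k, T i k = T k i) ->
  \sum_(0 <= i < N) \sum_(0 <= k < N) T i k
  = \sum_(0 <= i < N) T i i + 2 * \sum_(0 <= i < N) \sum_(0 <= k < i) T i k.
Proof.
move=> TC; elim: N => [|N IH]; first by rewrite !big_geq // mulr0 addr0.
rewrite big_nat_recr //= big_nat_recr //=.
under eq_bigr do rewrite big_nat_recr //=.
rewrite big_split /= IH !big_nat_recr //= mulrDr.
under [X in _ + X + _]eq_bigr do rewrite TC.
rewrite [2 * \sum_(0 <= k < N) T N k]mulr_natl mulr2n.
by ring.
Qed.

(** * The discrete estimate *)

(** The points are given by [u j = e(x_j)] and [v j = e(t_j)]. *)
Section Discrete.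
Context {C : numClosedFieldType} {J : finType}.
Variables (u v : J -> C) (N : nat).
Hypotheses (u1 : forall j, `|u j| = 1) (v1 : forall j, `|v j| = 1).

(** The character [e(n x_j + n^2 t_j)], indexed from 0: the index [n] stands for
the frequency [n.+1]. *)
Definition quadratic_phase (n : nat) (j : J) : C :=
  u j ^+ n.+1 * v j ^+ (n.+1 ^ 2).
Local Notation phase := quadratic_phase.

(** With [h = i - k], the difference of squares is [h] times the sum of the two
frequencies, which is [i + k + 2] in the shifted indexing. *)
Lemma phase_correlation (c : J -> C) (i k : nat) : (k < i)%N ->
  \sum_j c j * (phase i j * (phase k j)^*)
  = trigsum (fun j => c j * u j ^+ (i - k)) (fun j => v j ^+ (i - k))
      (i + k + 2).
Proof.
move=> lt_ki; apply: eq_bigr => j _; rewrite -mulrA; congr (_ * _).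
rewrite /quadratic_phase rmorphM /= mulrACA -exprM.
have {1}-> : i.+1 = (k.+1 + (i - k))%N by lia.
have -> : (i.+1 ^ 2 = k.+1 ^ 2 + (i - k) * (i + k + 2))%N.
  by rewrite -!mulnn; nia.
by rewrite !expr_conj_shift.
Qed.

(** The diagonal pairs [n = n'] give the first term. By symmetry the other pairs
may be taken with [n > n'], and the map to [(h, s)] is injective with
[0 < h < N] and [s < 2N]; then [phase_removal] at the points [v j ^+ h] strips
the factors [u j ^+ h] and doubles the range of [s]. *)
Lemma kernel_second_moment (b : J -> C) : (forall j, 0 <= b j) ->
  \sum_j \sum_k b j * b k * `|\sum_(0 <= n < N) phase n j * (phase n k)^*| ^+ 2
  <= N%:R * (\sum_j b j) ^+ 2 +
     8 * \sum_(1 <= h < N) \sum_(0 <= s < 4 * N) `|trigsum b v (h * s)| ^+ 2.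
Proof.
move=> b0.
have bR j : (b j)^* = b j by rewrite conj_Creal // ger0_real.
under eq_bigr do under eq_bigr => k _ do rewrite -{1}[b k]bR.
rewrite -sum_sqr_correlation.
set T := fun i k => `|\sum_j b j * (phase i j * (phase k j)^*)| ^+ 2.
rewrite (@sum_symmetric_triangle _ T); last first.
  move=> i k; rewrite /T -[in RHS]norm_conjC rmorph_sum /=; congr (`|_| ^+ 2).
  apply: eq_bigr => j _; rewrite [(b j * _)^*]rmorphM /= [(phase k j * _)^*]rmorphM /=.
  by rewrite conjCK bR [X in _ = _ * X]mulrC.
have p1 i j : `|phase i j| = 1.
  by rewrite /quadratic_phase normrM !normrX u1 v1 !expr1n mulr1.
apply: lerD.
  rewrite (eq_bigr (fun=> (\sum_j b j) ^+ 2)); last first.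
    move=> i _; rewrite /T; under eq_bigr do rewrite -normCK p1 expr1n mulr1.
    by rewrite ger0_norm // sumr_ge0.
  by rewrite sumr_const_nat subn0 mulr_natl.
have -> : 8 = 2 * 4 :> C by rewrite -natrM.
rewrite -mulrA ler_wpM2l ?ler0n //.
pose G h s := `|trigsum (fun j => b j * u j ^+ h) (fun j => v j ^+ h) s| ^+ 2.
have G0 h s : 0 <= G h s by rewrite exprn_ge0.
apply: (@le_trans _ _ (\sum_(1 <= h < N) \sum_(0 <= s < N + N) G h s)).
  rewrite big_mkord big_geq_mkord /=.
  under eq_bigr => i _ do
    rewrite big_mkord (big_ord_widen N (T i) (ltnW (ltn_ord i))).
  under [leRHS]eq_bigr do rewrite big_mkord.
  rewrite !pair_big_dep /=.
  (* Both values are in range, so [insubd] leaves them unchanged. *)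
  pose phi (q : 'I_N * 'I_N) : 'I_N * 'I_(N + N) :=
    (insubd q.1 (q.1 - q.2)%N, insubd (lshift N q.1) (q.1 + q.2 + 2)%N).
  have phi1 (q : 'I_N * 'I_N) : (phi q).1 = (q.1 - q.2)%N :> nat.
    rewrite /= insubdK // /in_mem /=.
    exact: leq_ltn_trans (leq_subr _ _) (ltn_ord _).
  have phi2 (q : 'I_N * 'I_N) : (q.2 < q.1)%N -> (phi q).2 = (q.1 + q.2 + 2)%N :> nat.
    move=> lt; rewrite /= insubdK // /in_mem /=.
    by have := ltn_ord q.1; lia.
  rewrite (eq_bigr (fun q => G (phi q).1 (phi q).2)); last first.
    by move=> q lt; rewrite phi1 phi2 // /T phase_correlation.
  apply: (sum_inj_le _ _ phi (fun q => G q.1 q.2)) => //.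
    move=> [i k] [i' k'] lt lt' /(f_equal (fun q => (val q.1, val q.2))) /=.
    move=> /[dup] /(f_equal fst) /= e1 /(f_equal snd) /= e2.
    move: (phi1 (i, k)) (phi1 (i', k')) (phi2 (i, k) lt) (phi2 (i', k') lt').
    move=> /= E1 E1' E2 E2'; rewrite E1 E1' in e1; rewrite E2 E2' in e2.
    rewrite /in_mem /= in lt lt'.
    by congr (_, _); apply: val_inj => /=; lia.
  by move=> q lt; rewrite andbT phi1 subn_gt0.
rewrite mulr_sumr; apply: ler_sum_nat => h /andP[h1 hN].
have -> : (N + N = N.*2)%N by rewrite addnn.
apply: le_trans (phase_removal _ _ _ _) _.
  by move=> j; rewrite normrX v1 expr1n.
rewrite (_ : (N.*2 + N.*2 = 4 * N)%N); last by lia.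
apply: eq_ler; congr (_ * _).
apply: eq_bigr => s _; congr (`|_| ^+ 2); apply: eq_bigr => j _.
by rewrite normrM normrX u1 expr1n mulr1 ger0_norm // exprM.
Qed.

Variables (near : J -> pred J) (K D : nat).
Hypotheses (cardJ : (#|J| <= N)%N) (cardnear : forall j, (#|near j| <= K)%N).
Hypothesis far : forall j k, ~~ near j k -> 2 <= N%:R * `|v j - v k|.
Hypothesis divisorsD :
  forall l, (0 < l < 4 * N ^ 2)%N -> (size (divisors l) <= D)%N.

Let sum_sqr_le (b : J -> C) : (forall j, 0 <= b j) ->
  (\sum_j b j) ^+ 2 <= N%:R * \sum_j b j ^+ 2.
Proof.
move=> b0; have := cauchy_schwarz (fun=> 1) b.
under eq_bigr do rewrite mul1r.
under [X in X * _]eq_bigr do rewrite normr1 expr1n.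
rewrite sumr_const ger0_norm ?sumr_ge0 //.
under [X in _ * X]eq_bigr do rewrite ger0_norm //.
move=> /le_trans; apply; rewrite ler_wpM2r ?ler_nat //.
by apply: sumr_ge0 => j _; rewrite exprn_ge0.
Qed.

(** The frequencies [h * s] with [s > 0] are handled by the divisor bound and
the large sieve, those with [s = 0] by the Cauchy-Schwarz inequality. *)
Lemma kernel_second_moment_le (b : J -> C) : (forall j, 0 <= b j) ->
  \sum_j \sum_k b j * b k * `|\sum_(0 <= n < N) phase n j * (phase n k)^*| ^+ 2
  <= (9 + 128 * K.+1 * D)%:R * N%:R ^+ 2 * \sum_j b j ^+ 2.
Proof.
move=> b0; apply: le_trans (kernel_second_moment _ b0) _.
have [N0|Npos] := posnP N.
  by rewrite N0 mul0r expr0n mulr0 mul0r add0r big_geq ?mulr0.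
set X := \sum_j b j ^+ 2.
pose g l := `|trigsum b v l| ^+ 2.
have g0 l : 0 <= g l by rewrite exprn_ge0.
have gzero : g 0%N <= N%:R * X.
  rewrite /g /trigsum; under eq_bigr do rewrite expr0 mulr1.
  by rewrite ger0_norm ?sumr_ge0 // sum_sqr_le.
have sieve : \sum_(0 <= l < N * (4 * N)) g l <= 16 * K.+1%:R * N%:R ^+ 2 * X.
  apply: le_trans (large_sieve b v near K N _ v1 b0 cardJ _ cardnear far) _.
    by rewrite -mulnn; nia.
  rewrite !natrM; apply: eq_ler.
  rewrite /X; ring.
have divs : \sum_(1 <= h < N) \sum_(1 <= s < 4 * N) g (h * s)%N
    <= D%:R * (16 * K.+1%:R * N%:R ^+ 2 * X).
  apply: le_trans (sum_divisors_le g N (4 * N) D g0 _) _.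
    by move=> l lN; apply: divisorsD; rewrite -mulnn mulnCA.
  by rewrite ler_wpM2l.
have main : \sum_(1 <= h < N) \sum_(0 <= s < 4 * N) g (h * s)%N
    <= N%:R * (N%:R * X) + D%:R * (16 * K.+1%:R * N%:R ^+ 2 * X).
  under eq_bigr do rewrite big_ltn ?muln_gt0 // muln0.
  rewrite big_split /= lerD // sumr_const_nat -[leLHS]mulr_natl.
  by apply: ler_pM; rewrite ?ler0n // ler_nat leq_subr.
apply: le_trans (lerD (ler_wpM2l (ler0n _ _) (sum_sqr_le b b0))
  (ler_wpM2l (ler0n _ _) main)) _.
apply: eq_ler.
rewrite -/X !(natrD, natrM); ring.
Qed.

(** The duality argument: [S] is paired with itself through the coefficients
[c j], chosen so that [c j * F j = |F j|^4]. *)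
Lemma discrete_l4 (a : nat -> C) :
  \sum_j `|\sum_(0 <= n < N) a n * phase n j| ^+ 4
  <= (9 + 128 * K.+1 * D)%:R * N%:R ^+ 2 * (\sum_(0 <= n < N) `|a n| ^+ 2) ^+ 2.
Proof.
pose F j := \sum_(0 <= n < N) a n * phase n j.
pose c j := `|F j| ^+ 2 * (F j)^*.
pose K' j k := \sum_(0 <= n < N) phase n j * (phase n k)^*.
set A := \sum_(0 <= n < N) _; set Q := _ * N%:R ^+ 2.
rewrite -/(F _).
set S := \sum_j _.
have S0 : 0 <= S by apply: sumr_ge0 => j _; rewrite exprn_ge0.
have A0 : 0 <= A by apply: sumr_ge0 => n _; rewrite exprn_ge0.
have Q0 : 0 <= Q by rewrite mulr_ge0 ?exprn_ge0 ?ler0n.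
(* The adjoint operator applied to [c]. *)
pose g n := \sum_j c j * phase n j.
have Sg : S = \sum_(0 <= n < N) a n * g n.
  rewrite /g; under [RHS]eq_bigr do rewrite mulr_sumr.
  rewrite exchange_big /=; apply: eq_bigr => j _.
  transitivity (c j * F j).
    by rewrite /c -mulrA [(F j)^* * _]mulrC -normCK -exprD.
  by rewrite /F mulr_sumr; apply: eq_bigr => n _; rewrite mulrCA.
pose E := \sum_(0 <= n < N) `|g n| ^+ 2.
(* First Cauchy-Schwarz: over the frequencies. *)
have SE : S ^+ 2 <= A * E.
  rewrite -(ger0_norm S0) Sg /A /E !big_mkord.
  exact: (cauchy_schwarz (fun n : 'I_N => a n) (fun n : 'I_N => g n)).
have EE : E = \sum_j \sum_k c j * (c k)^* * K' j k.
  rewrite /E; under eq_bigr => n _ do rewrite normCK rmorph_sum big_distrlr /=.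
  rewrite exchange_big /=; apply: eq_bigr => j _.
  rewrite exchange_big /=; apply: eq_bigr => k _.
  rewrite mulr_sumr; apply: eq_bigr => n _.
  by rewrite [(c k * _)^*]rmorphM /= mulrACA.
have E0 : 0 <= E by apply: sumr_ge0 => n _; rewrite exprn_ge0.
pose x (q : J * J) := `|F q.1| ^+ 2 * `|F q.2| ^+ 2.
pose y (q : J * J) := `|F q.1| * `|F q.2| * `|K' q.1 q.2|.
have x0 q : 0 <= x q by rewrite mulr_ge0 ?exprn_ge0.
have y0 q : 0 <= y q by rewrite !mulr_ge0.
(* Second Cauchy-Schwarz: over the pairs of points, with
   [|F_j|^3 |F_k|^3 |K_jk| = x (j, k) * y (j, k)]. *)
have ExY : E <= \sum_q x q * y q.
  rewrite -(ger0_norm E0) EE pair_big /=.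
  apply: le_trans (ler_norm_sum _ _ _) _; apply: ler_sum => -[j k] _ /=.
  rewrite normrM [`|(c j * _)|]normrM norm_conjC /c [`|(`|F j| ^+ 2 * _)|]normrM.
  rewrite [`|(`|F k| ^+ 2 * _)|]normrM !norm_conjC /x /y /=.
  rewrite (ger0_norm (exprn_ge0 2 (normr_ge0 (F j)))).
  rewrite (ger0_norm (exprn_ge0 2 (normr_ge0 (F k)))).
  apply: eq_ler; ring.
have x2 : \sum_q `|x q| ^+ 2 = S ^+ 2.
  rewrite expr2 {1}/S mulr_suml.
  under [RHS]eq_bigr do rewrite mulr_sumr.
  rewrite pair_big /=; apply: eq_bigr => -[j k] _ /=.
  by rewrite (ger0_norm (x0 _)) /x exprMn -!exprM.
have y2 : \sum_q `|y q| ^+ 2 <= Q * S.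
  have := kernel_second_moment_le (fun j => `|F j| ^+ 2) _.
  move=> /(_ (fun j => exprn_ge0 _ (normr_ge0 _))).
  under [\sum_j (_ ^+ 2) ^+ 2]eq_bigr do rewrite -exprM.
  apply: le_trans; rewrite pair_big /=; apply: eq_ler.
  by apply: eq_bigr => -[j k] _; rewrite (ger0_norm (y0 _)) /y /= !exprMn.
have E2 : E ^+ 2 <= S ^+ 2 * (Q * S).
  apply: (@le_trans _ _ (`|\sum_q x q * y q| ^+ 2)).
    rewrite lerXn2r ?nnegrE //; apply: le_trans ExY _.
    apply: real_ler_norm; apply: ger0_real; apply: sumr_ge0 => q _.
    exact: mulr_ge0.
  by apply: le_trans (cauchy_schwarz x y) _; rewrite x2 ler_wpM2l ?exprn_ge0.
have [->|Sn0] := eqVneq S 0; first by rewrite mulr_ge0 ?exprn_ge0.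
have Spos : 0 < S ^+ 3 by rewrite exprn_gt0 // lt_def Sn0.
rewrite -(ler_pM2l Spos).
have -> : S ^+ 3 * S = (S ^+ 2) ^+ 2 by ring.
apply: (@le_trans _ _ ((A * E) ^+ 2)).
  by rewrite lerXn2r ?nnegrE ?mulr_ge0 ?exprn_ge0.
rewrite exprMn; apply: le_trans (ler_wpM2l (exprn_ge0 _ A0) E2) _.
apply: eq_ler; ring.
Qed.

End Discrete.

(** * The divisor bound *)

(** A divisor [e] of [a * b] is the product of [gcdn e a], which divides [a], and
of [e %/ gcdn e a], which divides [b] by Gauss's lemma. *)
Lemma size_divisorsM (a b : nat) : (0 < a)%N -> (0 < b)%N ->
  (size (divisors (a * b)) <= size (divisors a) * size (divisors b))%N.
Proof.
move=> a0 b0; rewrite -(size_allpairs muln).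
apply: uniq_leq_size; first exact: divisors_uniq.
move=> e; rewrite -dvdn_divisors ?muln_gt0 ?a0 // => eab.
have g0 : (0 < gcdn e a)%N by rewrite gcdn_gt0 a0 orbT.
apply/allpairsP; exists (gcdn e a, e %/ gcdn e a)%N; split => /=.
- by rewrite -dvdn_divisors // dvdn_gcdr.
- rewrite -dvdn_divisors // -(@Gauss_dvdr _ (a %/ gcdn e a)).
    rewrite -(dvdn_pmul2l g0) mulnA.
    by rewrite ![(gcdn e a * _)%N]mulnC !divnK ?dvdn_gcdl ?dvdn_gcdr.
  rewrite /coprime -(eqn_pmul2l g0) muln1 muln_gcdr.
  by rewrite ![(gcdn e a * (_ %/ _))%N]mulnC !divnK ?dvdn_gcdl ?dvdn_gcdr.
- by rewrite mulnC divnK // dvdn_gcdl.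
Qed.

Lemma size_divisors_pfactor (p v : nat) : prime p ->
  (size (divisors (p ^ v)) <= v.+1)%N.
Proof.
move=> pp; rewrite -[leqRHS](size_iota 0) -[leqRHS](size_map (expn p)).
apply: uniq_leq_size; first exact: divisors_uniq.
move=> e; rewrite -dvdn_divisors ?expn_gt0 ?prime_gt0 //.
case/(dvdn_pfactor _ _ pp) => i iv ->; apply: map_f.
by rewrite mem_iota.
Qed.

Lemma bernoulli {R : realDomainType} (x : R) (n : nat) : 0 <= x ->
  1 + n%:R * x <= (1 + x) ^+ n.
Proof.
move=> x0; elim: n => [|n IH]; first by rewrite mul0r addr0 expr0.
rewrite exprS; apply: (@le_trans _ _ ((1 + x) * (1 + n%:R * x))).
  have := ler0n R n; rewrite -addn1 natrD; nra.
by rewrite ler_wpM2l // addr_ge0.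
Qed.

(** Call [n] [k]-rough when its prime factors are all at least [k]. If
[k >= 2^(1/d)] then removing a prime factor [p] from a [k]-rough number at most
halves the number of divisors, while [p^d >= 2], so the constant 1 works. There
are finitely many smaller primes; passing from [p.+1]-rough to [p]-rough numbers
splits off a power [p^v], whose [v + 1] divisors are at most a constant times
[2^(v d) <= (p^v)^d]. *)
Lemma divisor_bound {R : realType} (d : R) : 0 < d ->
  exists2 C : R, 0 < C &
    forall n, (0 < n)%N -> (size (divisors n))%:R <= C * n%:R `^ d.
Proof.
move=> d0.
pose rough k n := forall p, prime p -> (p %| n)%N -> (k <= p)%N.
suff bound k : exists2 C : R, 0 < C & forall n, (0 < n)%N -> rough k n ->
    (size (divisors n))%:R <= C * n%:R `^ d.
  by have [C C0 hC] := bound 0%N; exists C => // n n0; apply: hC.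
have powRn (m : nat) (v : nat) : (m ^ v)%:R `^ d = (m%:R `^ d) ^+ v :> R.
  transitivity ((m%:R : R) `^ (d * v%:R)).
    by rewrite natrX -(powR_mulrn v (ler0n R m)) -powRrM [in LHS]mulrC.
  by rewrite powRrM powR_mulrn // powR_ge0.
pose k0 := Num.bound (2 `^ d^-1 : R).
have k0P p : (k0 <= p)%N -> 2 <= p%:R `^ d :> R.
  move=> k0p; rewrite [leLHS](_ : 2 = (2 `^ d^-1) `^ d); last first.
    by rewrite -powRrM mulVf ?lt0r_neq0 // powRr1 ?ler0n.
  apply: (ge0_ler_powR (ltW d0)); rewrite ?nnegrE ?powR_ge0 ?ler0n //.
  apply: le_trans (ltW (archi_boundP (powR_ge0 _ _))) _.
  by rewrite ler_nat.
have big l : (k0 <= l)%N -> exists2 C : R, 0 < C &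
    forall n, (0 < n)%N -> rough l n ->
    (size (divisors n))%:R <= C * n%:R `^ d.
  move=> k0l.
  exists 1 => // n; elim/ltn_ind: n => n IH n0 rn.
  have [n1|n1] := leqP n 1.
    have -> : n = 1%N by lia.
    by rewrite powR1 mulr1 (_ : divisors 1 = [:: 1%N]).
  have [p pp pn] : exists2 p, prime p & (p %| n)%N.
    by exists (pdiv n); [exact: pdiv_prime | exact: pdiv_dvd].
  have q0 : (0 < n %/ p)%N by rewrite divn_gt0 ?prime_gt0 // dvdn_leq.
  have qn : (n %/ p < n)%N by rewrite ltn_Pdiv // prime_gt1.
  have rq : rough l (n %/ p)%N.
    by move=> r pr rq; apply: rn => //; rewrite (dvdn_trans rq) // dvdn_div.
  rewrite mul1r -[n in leRHS](divnK pn) natrM powRM ?ler0n //.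
  rewrite -[n in leLHS](divnK pn).
  apply: (@le_trans _ _ ((size (divisors (n %/ p)) * 2)%:R)).
    rewrite ler_nat; apply: leq_trans (size_divisorsM _ _ q0 (prime_gt0 pp)) _.
    by rewrite leq_mul2l -[p in divisors p]expn1 (size_divisors_pfactor p 1 pp) orbT.
  rewrite natrM ler_pM ?ler0n //; first by rewrite -[leRHS]mul1r IH.
  by apply: k0P; apply: leq_trans k0l _; apply: rn.
suff below j : exists2 C : R, 0 < C &
    forall n, (0 < n)%N -> rough (k0 - j)%N n ->
    (size (divisors n))%:R <= C * n%:R `^ d.
  have [/big//|kk0] := leqP k0 k.
  by have := below (k0 - k)%N; rewrite subKn // ltnW.
elim: j => [|j [C C0 hC]]; first by apply: big; rewrite subn0.
have [jk0|k0j] := ltnP j k0; last first.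
  by exists C => // n n0 rn; apply: hC => // p pp pn; have := rn p pp pn; lia.
set p := (k0 - j.+1)%N.
have pE : (k0 - j)%N = p.+1 by rewrite /p; lia.
have [pp|np] := boolP (prime p); last first.
  exists C => // n n0 rn; apply: hC => // r pr rdn; rewrite pE.
  rewrite ltn_neqAle (rn r pr rdn) andbT.
  by apply: contraNneq np => ->.
pose x : R := 2 `^ d - 1.
have x0 : 0 < x.
  have : 1 `^ d < 2 `^ d :> R.
    by apply: (gt0_ltr_powR d0); rewrite ?nnegrE ?ler01 ?ler0n ?ltr1n.
  by rewrite subr_gt0 powR1.
have xV0 : 0 < x^-1 by rewrite invr_gt0.
(* [v + 1 <= (1 + 1/x) (1 + v x)], and Bernoulli bounds [1 + v x] by
   [(1 + x)^v = 2^(d v)]. *)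
exists (C * (1 + x^-1)); first by rewrite mulr_gt0 // addr_gt0.
move=> n n0 rn; have [m cop nE] := pfactor_coprime pp n0.
set v := logn p n in nE.
have m0 : (0 < m)%N by move: n0; rewrite nE muln_gt0 => /andP[].
have rm : rough (k0 - j)%N m.
  move=> r pr rdm; rewrite pE ltn_neqAle; apply/andP; split; last first.
    by apply: rn => //; rewrite nE dvdn_mulr.
  apply: contraTneq cop => ->.
  by rewrite prime_coprime // negbK.
have vle : v.+1%:R <= (1 + x^-1) * (p ^ v)%:R `^ d.
  rewrite powRn; apply: (@le_trans _ _ ((1 + x^-1) * (1 + v%:R * x))).
    have : x^-1 * x = 1 by rewrite mulVf ?lt0r_neq0.
    have := ler0n R v; rewrite -addn1 natrD; nra.
  rewrite ler_wpM2l ?addr_ge0 ?(ltW xV0) //.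
  apply: le_trans (bernoulli x v (ltW x0)) _.
  rewrite /x addrC subrK lerXn2r ?nnegrE ?powR_ge0 //.
  by apply: (ge0_ler_powR (ltW d0)); rewrite ?nnegrE ?ler0n // ler_nat prime_gt1.
rewrite nE natrM powRM ?ler0n //.
have -> : C * (1 + x^-1) * (m%:R `^ d * (p ^ v)%:R `^ d) =
   C * m%:R `^ d * ((1 + x^-1) * (p ^ v)%:R `^ d) by ring.
apply: (@le_trans _ _ ((size (divisors m) * v.+1)%:R)).
  rewrite ler_nat.
  apply: leq_trans (size_divisorsM _ _ m0 _) _; first by rewrite expn_gt0 prime_gt0.
  by rewrite leq_mul2l size_divisors_pfactor ?orbT.
by rewrite natrM ler_pM ?ler0n // hC.
Qed.

(** * Separation of the points on the unit circle *)

Local Notation expe := Defs.expe.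

(** Concavity: the slope of [sin] on [[0, x]] is at least its slope on
[[x, pi / 2]]. *)
Lemma jordan_sin {R : realType} (x : R) : 0 < x < pi / 2 ->
  2 * x <= pi * sin x.
Proof.
move=> /andP[x0 xpi].
have [c /[!in_itv] /= /andP[c0 cx] sc] :
    exists2 c, c \in `]0, x[%R & sin x - sin 0 = cos c * (x - 0).
  apply: MVT => //.
  by apply: continuous_subspaceT => y; apply: continuous_sin.
have [e /[!in_itv] /= /andP[xe epi] se] :
    exists2 e, e \in `]x, (pi / 2)[%R &
      sin (pi / 2) - sin x = cos e * (pi / 2 - x).
  apply: MVT => //.
  by apply: continuous_subspaceT => y; apply: continuous_sin.
rewrite sin0 !subr0 in sc; rewrite sin_pihalf in se.
have cose : cos e <= cos c.
  have pi0 := pi_gt0 R.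
  by rewrite ltW // ltr_cos ?in_itv /=; first lra; apply/andP; split; lra.
have : 2 <= pi * cos c by nra.
by rewrite sc; nra.
Qed.

Lemma normc_complexE {R : realType} (z : R[i]) : `|z| = (Normc.normc z)%:C%C.
Proof. by []. Qed.

Lemma expeD {R : realType} (x y : R) : expe (x + y) = expe x * expe y.
Proof.
rewrite /Defs.expe mulrDr cosD sinD; apply/eqP; rewrite eq_complex /=.
by rewrite [cos _ * sin _ + _]addrC !eqxx.
Qed.

Lemma expe0 {R : realType} : expe (0 : R) = 1.
Proof. by rewrite /Defs.expe mulr0 cos0 sin0. Qed.

Lemma expe_natmul {R : realType} (n : nat) (x : R) : expe (n%:R * x) = expe x ^+ n.
Proof.
elim: n => [|n IH]; first by rewrite mul0r expe0 expr0.
by rewrite -addn1 natrD mulrDl mul1r expeD IH exprD expr1.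
Qed.

Lemma norm_expe {R : realType} (x : R) : `|expe x| = 1.
Proof. by rewrite normc_complexE /= cos2Dsin2 sqrtr1. Qed.

Lemma norm_expeB {R : realType} (s t : R) :
  `|expe t - expe s| = (2 * `|sin (pi * (t - s))|)%:C%C.
Proof.
rewrite normc_complexE /=; congr (_%:C)%C.
rewrite -[RHS]ger0_norm ?mulr_ge0 // -sqrtr_sqr; congr Num.sqrt.
rewrite exprMn real_normK ?num_real //.
have -> : 2 * pi * t = pi * (t - s) + (pi * (t - s) + 2 * pi * s) by ring.
have := cos2Dsin2 (pi * (t - s)); have := cos2Dsin2 (2 * pi * s).
rewrite !(cosD, sinD).
move: (cos (2 * pi * s)) (sin (2 * pi * s)) => c d cd1.
move: (cos _) (sin _) => a b ab1.
(* Written so that both factors simplify by [c^2 + d^2 = a^2 + b^2 = 1]. *)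
transitivity ((c ^+ 2 + d ^+ 2) *
  ((a ^+ 2 + b ^+ 2) ^+ 2 + 1 - 2 * (a ^+ 2 + b ^+ 2) + 4 * b ^+ 2)).
  ring.
by rewrite cd1 ab1; ring.
Qed.

Lemma norm_expeB_ge {R : realType} (N : nat) (s t : R) : (0 < N)%N ->
  N%:R^-1 <= `|t - s| -> `|t - s| <= 1 - N%:R^-1 ->
  2 <= N%:R * `|expe t - expe s|.
Proof.
move=> N0; wlog st : s t / s <= t.
  move=> H; have [|/ltW ts] := leP s t; first exact: H.
  by rewrite distrC => lb ub; rewrite [`|expe t - _|]distrC; apply: H.
rewrite ger0_norm ?subr_ge0 // norm_expeB.
set x := t - s => lb ub.
have NV : N%:R * N%:R^-1 = 1 :> R by rewrite mulfV // pnatr_eq0 -lt0n.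
have NV0 : 0 < N%:R^-1 :> R by rewrite invr_gt0 ltr0n.
have pi0 := pi_gt0 R.
have sin_ge : N%:R^-1 <= sin (pi * x).
  have [x12|x12|x12] := ltgtP x (1 / 2).
  - have := @jordan_sin _ (pi * x).
    have -> : 0 < pi * x < pi / 2 by nra.
    move=> /(_ isT); rewrite mulrCA ler_pM2l //; lra.
  - have := @jordan_sin _ (pi * (1 - x)).
    have -> : 0 < pi * (1 - x) < pi / 2 by nra.
    move=> /(_ isT); rewrite mulrCA ler_pM2l //.
    have -> : pi * (1 - x) = - (pi * x) + pi by ring.
    rewrite sinDpi sinN opprK; lra.
  - rewrite x12 mulrA mulr1 sin_pihalf; lra.
rewrite ger0_norm; last by apply: le_trans sin_ge; apply: ltW.
have -> : 2 = (2%:R)%:C%C :> R[i] by rewrite rmorph_nat.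
rewrite -[N%:R](rmorph_nat (real_complex R)) -rmorphM /= lecR.
have N0' : 0 < N%:R :> R by rewrite ltr0n.
nra.
Qed.

Local Open Scope classical_set_scope.
Local Open Scope ring_scope.

(** * The estimate for points in distinct strips *)

(** Pairs of strips that touch or overlap, cyclically: the first and the last strip
are adjacent modulo 1. *)
Definition neighbouring (N : nat) (j : 'I_N) : pred 'I_N :=
  fun k => [|| (k <= j.+1) && (j <= k.+1), j + N <= k.+1 | k + N <= j.+1]%N.

Lemma card_neighbouring (N : nat) (j : 'I_N) : (#|neighbouring N j| <= 5)%N.
Proof.
rewrite cardE -(size_map (@nat_of_ord N)).
apply: (@uniq_leq_size _ _ [:: j.-1; nat_of_ord j; j.+1; N.-1; 0]%N).
  by rewrite map_inj_uniq ?enum_uniq //; apply: ord_inj.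
move=> _ /mapP[k + ->]; rewrite mem_enum unfold_in => near; rewrite !inE.
move: near; rewrite /neighbouring.
have := ltn_ord k; have := ltn_ord j; lia.
Qed.

Lemma strip_separation {R : realType} (N : nat) (j k : 'I_N) (s t : R) :
  ~~ neighbouring N j k ->
  j%:R / N%:R <= s <= j.+1%:R / N%:R -> k%:R / N%:R <= t <= k.+1%:R / N%:R ->
  2 <= N%:R * `|expe s - expe t|.
Proof.
move=> far /andP[s1 s2] /andP[t1 t2].
have N0 : (0 < N)%N by apply: leq_ltn_trans (ltn_ord j).
have M0 : 0 < N%:R^-1 :> R by rewrite invr_gt0 ltr0n.
have NM : N%:R * N%:R^-1 = 1 :> R by rewrite mulfV // pnatr_eq0 -lt0n.
have mul_le (a b : nat) : (a <= b)%N -> a%:R / N%:R <= b%:R / N%:R :> R.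
  by move=> ab; rewrite ler_pM2r // ler_nat.
rewrite /neighbouring in far.
have [jk|kj] := leqP j k.
  have h1 := mul_le (j.+2)%N k; have h2 := mul_le (k.+2)%N (j + N)%N.
  have {}h1 := h1 ltac:(lia); have {}h2 := h2 ltac:(lia).
  rewrite -?natr1 ?natrD ?mulrDl ?mul1r ?NM in s2 t2 h1 h2.
  by apply: norm_expeB_ge => //; rewrite distrC ger0_norm; lra.
have h1 := mul_le (k.+2)%N j; have h2 := mul_le (j.+2)%N (k + N)%N.
have {}h1 := h1 ltac:(lia); have {}h2 := h2 ltac:(lia).
rewrite -?natr1 ?natrD ?mulrDl ?mul1r ?NM in s2 t2 h1 h2.
by apply: norm_expeB_ge => //; rewrite ger0_norm; lra.
Qed.

Lemma l2norm4 {R : realType} (N : nat) (a : nat -> R[i]) :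
  l2norm N a ^+ 4 = (\sum_(0 <= n < N) Normc.normc (a n.+1) ^+ 2) ^+ 2.
Proof.
rewrite (exprM _ 2 2) /l2norm sqr_sqrtr ?big_add1 //.
by apply: sumr_ge0 => n _; rewrite exprn_ge0 // -ler0c -normc_complexE.
Qed.

(** The constant is that of [discrete_l4] with at most 5 neighbours:
[128 * 6 = 768]. *)
Lemma discrete_l4_strips {R : realType} (N D : nat) (a : nat -> R[i])
    (z : 'I_N -> R * R) :
  (forall j : 'I_N, j%:R / N%:R <= (z j).2 <= j.+1%:R / N%:R) ->
  (forall l, (0 < l < 4 * N ^ 2)%N -> (size (divisors l) <= D)%N) ->
  \sum_j Normc.normc (expsum N a (z j)) ^+ 4
  <= (9 + 768 * D)%:R * N%:R ^+ 2 * l2norm N a ^+ 4.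
Proof.
move=> zS hD; rewrite l2norm4 -lecR.
have := discrete_l4 (fun j => expe (z j).1) (fun j => expe (z j).2) N
  (fun j => norm_expe _) (fun j => norm_expe _) (neighbouring N) 5 D.
rewrite card_ord => /(_ (leqnn _) (@card_neighbouring N)).
move=> /(_ (fun j k jk => strip_separation N j k _ _ jk (zS j) (zS k)) hD).
move=> /(_ (fun n => a n.+1)).
have -> : (128 * 6 = 768)%N by [].
rewrite !(rmorphXn, rmorphM) /= !rmorph_nat !rmorph_sum /=.
apply: etrans; congr (_ <= _).
  apply: eq_bigr => j _; rewrite rmorphXn normc_complexE; congr (_%:C%C ^+ 4).
  rewrite /expsum big_add1; congr Normc.normc; apply: eq_bigr => n _.
  by rewrite expeD /quadratic_phase expe_natmul -natrX expe_natmul.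
by congr (_ * _ ^+ 2); apply: eq_bigr => n _; rewrite rmorphXn.
Qed.

(** * From points to boxes *)

(** The integral of a nonnegative function is a supremum over simple functions
below it, so monotonicity holds without measurability. This spares proving
[|f|^4] restricted to [E] measurable. *)
Lemma ge0_le_integralT {d} {T : measurableType d} {R : realType}
    (mu : {measure set T -> \bar R}) (f g : T -> \bar R) :
  (forall x, 0 <= f x)%E -> (forall x, f x <= g x)%E ->
  (\int[mu]_x f x <= \int[mu]_x g x)%E.
Proof.
move=> f0 fg; have g0 x : (0 <= g x)%E by apply: le_trans (fg x).
rewrite !ge0_integralTE //; apply: le_ereal_sup => _ [h hf <-].
by exists h => // x; apply: le_trans (hf x) (fg x).
Qed.

Lemma integral_step {d} {T : measurableType d} {R : realType}
    (mu : {measure set T -> \bar R}) {J : finType} (c : J -> R)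
    (A : J -> set T) :
  (forall j, 0 <= c j) -> (forall j, measurable (A j)) ->
  (\int[mu]_x (\sum_j (c j * \1_(A j) x)%:E) = \sum_j (c j)%:E * mu (A j))%E.
Proof.
move=> c0 mA; rewrite ge0_integral_sum //.
- apply: eq_bigr => j _.
  rewrite (integralZl_indic measurableT (fun=> A j)) //.
    by rewrite integral_indic ?setIT.
  by rewrite ltNge c0.
- by move=> j; apply/measurable_EFinP; apply: measurable_funM => //.
- by move=> j x _; rewrite lee_fin mulr_ge0.
Qed.

Lemma box_measure {R : realType} (w h : R) (B : set (R * R)) :
  0 < w -> 0 < h -> is_box w h B ->
  measurable B /\
  (@lebesgue_measure R \x @lebesgue_measure R)%E B = (w * h)%:E.
Proof.
move=> w0 h0 [x0 [t0 ->]]; split; first by apply: measurableX.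
rewrite product_measure1E //= !lebesgue_measure_itv /= !lte_fin !ltrDl w0 h0.
by rewrite -!EFinB -EFinM; congr (_ * _)%:E; ring.
Qed.

(** A positive supremum exceeds its half, so some value of [h] does too; this is
how boundedness stands in for compactness and continuity. *)
Lemma almost_maximum {R : realType} {T : Type} (A : set T) (h : T -> R) (M : R) :
  A !=set0 -> (forall x, A x -> 0 <= h x <= M) ->
  exists2 x, A x & forall y, A y -> h y <= 2 * h x.
Proof.
move=> [x0 Ax0] hM; pose s := sup (h @` A).
have hs : has_sup (h @` A).
  split; first by exists (h x0), x0.
  by exists M => _ [x Ax <-]; have /andP[] := hM x Ax.
have ub y : A y -> h y <= s by move=> Ay; apply: sup_upper_bound => //; exists y.
have [s0|s0] := leP s 0.
  exists x0 => // y Ay; have := ub y Ay; have /andP[] := hM x0 Ax0 => *; lra.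
have s20 : 0 < s / 2 by lra.
have [_ [x Ax <-] sx] := sup_adherent s20 hs.
exists x => // y Ay; have := ub y Ay; rewrite -/s in sx; lra.
Qed.

Lemma normc_ge0 {R : realType} (x : R[i]) : 0 <= Normc.normc x.
Proof. by rewrite -ler0c -normc_complexE. Qed.

Lemma normc_expsum_le {R : realType} (N : nat) (a : nat -> R[i]) (z : R * R) :
  Normc.normc (expsum N a z) <= \sum_(1 <= n < N.+1) Normc.normc (a n).
Proof.
rewrite -lecR -normc_complexE rmorph_sum.
apply: le_trans (ler_norm_sum _ _ _) _; apply: ler_sum => n _.
by rewrite normrM norm_expe mulr1.
Qed.

Lemma integral_expsum_boxes_le {R : realType} (N D : nat) (a : nat -> R[i])
    (B : nat -> set (R * R)) :
  (0 < N)%N ->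
  (forall j, (1 <= j <= N)%N ->
     is_box (N%:R^-1) ((N%:R ^+ 2)^-1) (B j) /\ B j `<=` @strip R N j) ->
  (forall l, (0 < l < 4 * N ^ 2)%N -> (size (divisors l) <= D)%N) ->
  (\int[@lebesgue_measure R \x @lebesgue_measure R]_z
     `| ((fun w => (Normc.normc (expsum N a w))%:E)
         \_ (\bigcup_(j in [set j : nat | (1 <= j <= N)%N]) B j)) z | `^ 4
   <= (2 * (9 + 768 * D)%:R * N%:R^-1 * l2norm N a ^+ 4)%:E)%E.
Proof.
move=> N0 hB hD.
have hBo (j : 'I_N) := hB j.+1 (ltn_ord j).
have NV0 : 0 < N%:R^-1 :> R by rewrite invr_gt0 ltr0n.
have N2V0 : 0 < (N%:R ^+ 2)^-1 :> R by rewrite invr_gt0 exprn_gt0 // ltr0n.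
pose F z := Normc.normc (expsum N a z) ^+ 4.
have F0 z : 0 <= F z by rewrite exprn_ge0 // normc_ge0.
have /choice[z zP] : forall j : 'I_N, exists w, B j.+1 w /\
    forall y, B j.+1 y -> F y <= 2 * F w.
  move=> j; have ne : B j.+1 !=set0.
    have [[x0 [t0 ->]] _] := hBo j; exists (x0, t0).
    by split; rewrite /= in_itv /= lexx lerDl ltW.
  have bd y : B j.+1 y ->
      0 <= F y <= (\sum_(1 <= n < N.+1) Normc.normc (a n)) ^+ 4.
    move=> _; rewrite F0 lerXn2r ?nnegrE ?normc_ge0 ?normc_expsum_le //.
    by apply: sumr_ge0 => n _; exact: normc_ge0.
  by have [w Bw wmax] := almost_maximum _ _ _ ne bd; exists w.
have strips (j : 'I_N) : j%:R / N%:R <= (z j).2 <= j.+1%:R / N%:R.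
  have [_ sub] := hBo j; have [Bz _] := zP j.
  have [_ /=] := sub _ Bz.
  by rewrite in_itv /= -natr1 addrK.
(* The step function equal to [c j] on the box [B j.+1] dominates [|f|^4]. *)
pose c j := 2 * F (z j).
have c0 j : 0 <= c j by rewrite mulr_ge0.
pose G (j : 'I_N) (w : R * R) := (c j * \1_(B j.+1) w)%:E.
have mB (j : 'I_N) := box_measure _ _ _ NV0 N2V0 (hBo j).1.
have G0 j w : (0 <= G j w)%E by rewrite lee_fin mulr_ge0.
apply: (@le_trans _ _ (\int[@lebesgue_measure R \x @lebesgue_measure R]_w
    \sum_(j < N) G j w)%E).
  apply: ge0_le_integralT => w; first exact: poweR_ge0.
  rewrite /patch; case: ifPn => [|_]; last first.
    rewrite abse0 poweR0r ?pnatr_eq0 //.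
    by apply: sume_ge0 => j _; exact: G0.
  rewrite inE => -[j /= /andP[j1 jN] Bw].
  rewrite /= ger0_norm ?normc_ge0 // powR_mulrn ?normc_ge0 //.
  have jN' : (j.-1 < N)%N by rewrite prednK.
  rewrite /G sumEFin lee_fin (bigD1 (Ordinal jN')) //= prednK //.
  rewrite indicE mem_set // mulr1 ler_wpDr //.
    by apply: sumr_ge0 => k _; rewrite mulr_ge0.
  by have [_] := zP (Ordinal jN'); rewrite /= prednK //; apply.
rewrite integral_step //; last by move=> j; case: (mB j).
rewrite (eq_bigr (fun j => (c j * (N%:R^-1 * (N%:R ^+ 2)^-1))%:E)); last first.
  by move=> j _; have [_ mBj] := mB j; rewrite [RHS]EFinM -mBj.
rewrite sumEFin lee_fin -mulr_suml -mulr_sumr.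
have := discrete_l4_strips N D a z strips hD; rewrite -/(F _).
set S := \sum_(j < N) F (z j) => SP.
have N2 : N%:R ^+ 2 * (N%:R ^+ 2)^-1 = 1 :> R.
  by rewrite mulfV // expf_neq0 // pnatr_eq0 -lt0n.
have -> : 2 * (9 + 768 * D)%:R * N%:R^-1 * l2norm N a ^+ 4
    = 2 * ((9 + 768 * D)%:R * N%:R ^+ 2 * l2norm N a ^+ 4)
      * (N%:R^-1 * (N%:R ^+ 2)^-1).
  rewrite -[LHS]mulr1 -[X in _ * X = _]N2.
  by move: (N%:R^-1) ((N%:R ^+ 2)^-1) => p q; ring.
apply: ler_wpM2r; first by rewrite mulr_ge0 // ltW.
by apply: ler_wpM2l.
Qed.

Theorem theorem1p6 (R : realType) :
  forall eps : R, 0 < eps ->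
  exists C : R, 0 < C /\
    forall (N : nat) (a : nat -> R[i]) (B : nat -> set (R * R)),
      (0 < N)%N ->
      (forall j : nat, (1 <= j <= N)%N ->
         is_box (N%:R^-1) ((N%:R ^+ 2)^-1) (B j) /\ B j `<=` @strip R N j) ->
      (LnormE 4 (\bigcup_(j in [set j : nat | (1 <= j <= N)%N]) B j)
         (expsum N a)
       <= (C * N%:R `^ eps * N%:R `^ (- (1 / 4)) * l2norm N a)%:E)%E.
Proof.
move=> eps eps0.
(* A divisor bound [l^d] with [l < 4 N^2] costs [N^(2 d)], whose fourth root
   has to be [N^eps]. *)
pose d := 2 * eps.
have d0 : 0 < d by rewrite mulr_gt0.
have [C0 C0pos hC0] := divisor_bound d d0.
pose K := 2 * (9 + 768 * (C0 * 4 `^ d)).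
have X0 : 0 < C0 * 4 `^ d by rewrite mulr_gt0 // powR_gt0 // ltr0n.
have K0 : 0 < K by rewrite /K; lra.
exists (K `^ 4^-1); split; first exact: powR_gt0.
move=> N a B N0 hB.
have N1 : 1 <= N%:R :> R by rewrite ler1n.
have N0' : 0 <= N%:R :> R := ler0n _ _.
set E := \bigcup_(j in _) B j.
pose D := Num.truncn (C0 * (4 * N ^ 2)%:R `^ d).
have D0 : 0 <= C0 * (4 * N ^ 2)%:R `^ d by rewrite mulr_ge0 ?powR_ge0 // ltW.
have hD l : (0 < l < 4 * N ^ 2)%N -> (size (divisors l) <= D)%N.
  move=> /andP[l0 lN]; rewrite truncn_ge_nat //.
  apply: le_trans (hC0 l l0) _; rewrite ler_wpM2l ?(ltW C0pos) //.
  by apply: (ge0_ler_powR (ltW d0)); rewrite ?nnegrE ?ler0n // ler_nat ltnW.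
have Deps : D%:R <= C0 * 4 `^ d * N%:R `^ (4 * eps).
  have /andP[DD _] := truncn_itv D0; apply: le_trans DD _.
  rewrite natrM natrX powRM ?exprn_ge0 // mulrA -powR_mulrn // -powRrM.
  by rewrite /d mulrA -natrM.
have Q1 : 1 <= N%:R `^ (4 * eps).
  rewrite -[leLHS](powRr0 N%:R); apply: ler_powR => //.
  by rewrite mulr_ge0 // ltW.
have KN : 2 * (9 + 768 * D)%:R <= K * N%:R `^ (4 * eps).
  have -> : K * N%:R `^ (4 * eps) =
      2 * (9 * N%:R `^ (4 * eps) + 768 * (C0 * 4 `^ d * N%:R `^ (4 * eps))).
    by rewrite /K; ring.
  by rewrite natrD natrM; move: Deps Q1; set X := C0 * _ * _; lra.
clearbody K.
have l2ge0 : 0 <= l2norm N a by exact: sqrtr_ge0.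
have bound := integral_expsum_boxes_le N D a B N0 hB hD.
rewrite /LnormE unlock -/E; rewrite -/E in bound.
set I := (\int[_]_x _)%E in bound *.
have I0 : (0 <= I)%E by apply: integral_ge0 => x _; exact: poweR_ge0.
have {}bound : (I <= (K * N%:R `^ (4 * eps) * N%:R^-1 * l2norm N a ^+ 4)%:E)%E.
  apply: le_trans bound _; rewrite lee_fin ler_wpM2r ?exprn_ge0 //.
  by rewrite ler_wpM2r // invr_ge0.
have V0 : 0 <= K * N%:R `^ (4 * eps) * N%:R^-1 * l2norm N a ^+ 4.
  by rewrite !mulr_ge0 ?exprn_ge0 ?invr_ge0 ?powR_ge0 ?(ltW K0).
apply: (@le_trans _ _
  ((K * N%:R `^ (4 * eps) * N%:R^-1 * l2norm N a ^+ 4)%:E `^ 4^-1)%E).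
  apply: gt0_ler_poweR => //; first by rewrite in_itv /= I0 leey.
  by rewrite in_itv /= lee_fin V0 leey.
have root4 (x : R) : 0 <= x -> (x `^ 4) `^ 4^-1 = x.
  by move=> x0; rewrite -powRrM mulfV ?pnatr_eq0 // powRr1.
have rootN : (N%:R `^ (4 * eps)) `^ 4^-1 = N%:R `^ eps :> R.
  by rewrite [4 * eps]mulrC powRrM root4 // powR_ge0.
have rootV : N%:R^-1 `^ 4^-1 = N%:R `^ (- (1 / 4)) :> R.
  by rewrite -powR_inv1 // -powRrM mulN1r div1r.
have rootl2 : (l2norm N a ^+ 4) `^ 4^-1 = l2norm N a.
  by rewrite -powR_mulrn // root4.
have ge1 : 0 <= K * N%:R `^ (4 * eps) by rewrite mulr_ge0 ?powR_ge0 // ltW.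
have ge2 : 0 <= K * N%:R `^ (4 * eps) * N%:R^-1 by rewrite mulr_ge0 ?invr_ge0.
rewrite poweR_EFin lee_fin (powRM _ ge2) ?exprn_ge0 // rootl2.
rewrite (powRM _ ge1) ?invr_ge0 // rootV (powRM _ (ltW K0)) ?powR_ge0 //.
by rewrite rootN.
Qed.
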